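(* Let $G$ be a graph obtained by taking clique-sums of bipartite graphs and odd cycles. Let $n_1<\cdots<n_r$ be positive integers such that $C_{2n_i+1}$ is an induced cycle in $G$ for all $1\le i\le r$, and such that every induced odd cycle $C$ in $G$ satisfies $C\simeq C_{2n_i+1}$ for some $i$. Then for all $s\ge2$, $$I(G)^{(s)}=\sum_{\substack{t\ge0,\ a_i\ge0,\\ s=t+(n_1+1)a_1+\cdots+(n_r+1)a_r}} I(G)^{t}J_{n_1}(G)^{a_1}\cdots J_{n_r}(G)^{a_r}.$$
   Context: All graphs are finite and simple, with no isolated vertices. If $G_1,G_2$ are graphs such that $G_1\cap G_2=K_r$ is a complete graph (on $r\ge 1$ vertices), with $G_1\neq K_r$ and $G_2\ne K_r$, then $G_1\cup G_2$ is called the clique-sum of $G_1$ and $G_2$ along $K_r$; a clique-sum of a finite collection of graphs is a graph obtained from them by repeatedly taking clique-sums. $C_m$ denotes the cycle on $m$ vertices. The edge ideal $I(G)$, over a field $\mathbb{K}$, is the ideal of $R=\mathbb{K}[x : x\in V(G)]$ generated by $\{xy : \{x,y\}\in E(G)\}$. For an odd cycle $C$ put $u_C=\prod_{x\in V(C)}x$, and let $J_n(G)\subset R$ be the ideal generated by $\{u_C : C\text{ is an induced odd cycle of }G\text{ of length }2n+1\}$. For an ideal $I$ in a Noetherian ring $R$, $I^{(s)}=\bigcap_{P\in\mathrm{Ass}(I)}(I^sR_P\cap R)$ is the $s$-th symbolic power; zeroth powers of ideals are $R$. The sum runs over integers $t,a_1,\dots,a_r$. *)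

(* Defs.v *)
From HB Require Import structures.
From mathcomp Require Import all_boot all_order all_algebra.
From mathcomp Require Import mpoly.

Set Implicit Arguments.
Unset Strict Implicit.
Unset Printing Implicit Defensive.

Import GRing.Theory.
Local Open Scope ring_scope.

(* Graphs live in an ambient finite type V, so that unions and intersections  *)
(* of graphs are literal.  Edges are two-element subsets of the vertex set.   *)
Definition edge_ok (V : finType) (W : {set V}) (E : {set {set V}}) : bool :=
  [forall e in E, (e \subset W) && (#|e| == 2)].

Record sgraph (V : finType) := SGraph {
  vset : {set V};
  edges : {set {set V}};
  edgesP : edge_ok vset edges }.

Section Graphs.
Variable V : finType.
Implicit Types (G H C : sgraph V) (W : {set V}).

Fact gunion_subproof G H :
  edge_ok (vset G :|: vset H) (edges G :|: edges H).
Proof.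
apply/forall_inP=> e; rewrite inE.
case/orP=> [/(forall_inP (edgesP G))|/(forall_inP (edgesP H))] /andP[sub ->];
by rewrite andbT (subset_trans sub) ?subsetUl ?subsetUr.
Qed.
Definition gunion G H := SGraph (gunion_subproof G H).

Fact ginter_subproof G H :
  edge_ok (vset G :&: vset H) (edges G :&: edges H).
Proof.
apply/forall_inP=> e; rewrite inE => /andP[].
move=> /(forall_inP (edgesP G))/andP[sG ->].
by move=> /(forall_inP (edgesP H))/andP[sH _]; rewrite andbT subsetI sG.
Qed.
Definition ginter G H := SGraph (ginter_subproof G H).

Fact complete_subproof W :
  edge_ok W [set e : {set V} | (e \subset W) && (#|e| == 2)].
Proof. by apply/forall_inP=> e; rewrite inE. Qed.
Definition complete W := SGraph (complete_subproof W).

Definition no_isolated G : Prop :=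
  forall x, x \in vset G -> exists y, [set x; y] \in edges G.

Definition bipartite G : Prop :=
  exists A B : {set V}, [/\ [disjoint A & B], A :|: B = vset G &
    forall e, e \in edges G ->
      exists x y, [/\ x \in A, y \in B & e = [set x; y]]].

(* G is isomorphic to the cycle C_m; ordS i is i + 1 mod m. *)
Definition is_cycle (m : nat) G : Prop :=
  (3 <= m)%N /\
  exists f : 'I_m -> V, [/\ injective f,
    vset G = [set f i | i : 'I_m] &
    edges G = [set [set f i; f (ordS i)] | i : 'I_m]].

Definition induced_subgraph H G : Prop :=
  vset H \subset vset G /\
  edges H = [set e in edges G | e \subset vset H].

Definition induced_cycle (m : nat) G C : Prop :=
  induced_subgraph C G /\ is_cycle m C.

Definition clique_sum G1 G2 G : Prop :=
  exists K : {set V}, [/\ K != set0, ginter G1 G2 = complete K,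
    G1 <> complete K, G2 <> complete K & G = gunion G1 G2].

Inductive clique_sums_of (P : sgraph V -> Prop) : sgraph V -> Prop :=
| CliqueSumsBase G : P G -> clique_sums_of P G
| CliqueSumsStep G1 G2 G :
    clique_sums_of P G1 -> clique_sums_of P G2 ->
    clique_sum G1 G2 G -> clique_sums_of P G.

Definition bipartite_or_odd_cycle G : Prop :=
  no_isolated G /\ (bipartite G \/ exists n, is_cycle n.*2.+1 G).

End Graphs.

(* Ideals are Prop-valued subsets, since membership need not be decidable. *)
Section Ideals.
Variable R : comNzRingType.
Implicit Types I J P S : R -> Prop.

Definition is_ideal I : Prop :=
  [/\ I 0, forall x y, I x -> I y -> I (x + y) &
      forall a x, I x -> I (a * x)].

Definition is_prime_ideal P : Prop :=
  [/\ is_ideal P, ~ P 1 & forall x y, P (x * y) -> P x \/ P y].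

Definition ideal_gen S : R -> Prop := fun x =>
  exists (k : nat) (a b : 'I_k -> R),
    (forall i, S (b i)) /\ x = \sum_(i < k) a i * b i.

Definition ideal_one : R -> Prop := fun _ => True.

Definition ideal_mul I J : R -> Prop :=
  ideal_gen (fun z => exists x y, [/\ I x, J y & z = x * y]).

Definition ideal_exp I (s : nat) : R -> Prop := iter s (ideal_mul I) ideal_one.

Definition ideal_sum (A : Type) (Q : A -> Prop) (F : A -> R -> Prop) :
    R -> Prop :=
  ideal_gen (fun x => exists a, Q a /\ F a x).

(* P is in Ass(I) = Ass_R(R/I): P is prime, and is the annihilator (I : f) of *)
(* the class of some f in R/I.                                                *)
Definition associated_prime I P : Prop :=
  is_prime_ideal P /\ exists f, forall g, P g <-> I (g * f).

End Ideals.

(* For a domain R, the localization R_P is realized inside the fraction field. *)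
Section Symbolic.
Variable R : idomainType.
Implicit Types I P : R -> Prop.

Definition localization P : {fraction R} -> Prop := fun z =>
  exists a g : R, ~ P g /\ z = tofrac a / tofrac g.

(* the ideal I R_P of R_P *)
Definition extended P I : {fraction R} -> Prop := fun z =>
  exists (k : nat) (c : 'I_k -> {fraction R}) (b : 'I_k -> R),
    [/\ forall i, localization P (c i), forall i, I (b i) &
        z = \sum_(i < k) c i * tofrac (b i)].

Definition symbolic_power I (s : nat) : R -> Prop := fun f =>
  forall P, associated_prime I P -> extended P (ideal_exp I s) (tofrac f).

End Symbolic.

(* The variables of {mpoly K[#|V|]} are indexed by V through enum_rank. *)
Section GraphIdeals.
Variables (K : fieldType) (V : finType).
Implicit Types G : sgraph V.

Definition vvar (x : V) : {mpoly K[#|V|]} := 'X_(enum_rank x).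

Definition edge_ideal G : {mpoly K[#|V|]} -> Prop :=
  ideal_gen (fun f => exists x y,
    [set x; y] \in edges G /\ f = vvar x * vvar y).

Definition odd_cycle_ideal (n : nat) G : {mpoly K[#|V|]} -> Prop :=
  ideal_gen (fun f => exists C : sgraph V,
    induced_cycle n.*2.+1 G C /\ f = \prod_(x in vset C) vvar x).

End GraphIdeals.

Arguments edge_ideal K {V} G.
Arguments odd_cycle_ideal K {V} n G.

(* Main.v *)
Require Import Defs.
From HB Require Import structures.
From mathcomp Require Import all_boot all_order all_algebra.
From mathcomp Require Import mpoly.
From mathcomp Require Import zify.

(** Both sides of the equality are ideals spanned by monomials, and the theorem
is a weighted min-max statement about exponent vectors.

A minimal vertex cover [C] of [G] spans an associated prime of the edge ideal,
and localizing there shows that each exponent [w] of an element of the [s]-th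
symbolic power has weight at least [s] on every vertex cover
([symbolic_power_monomials]).  A monomial lies in the right-hand side as soon as
[w] contains a packing of edges, counted with value 1, and of induced odd
cycles on 2k + 1 vertices, counted with value k + 1, of total value [s]
([packable_mixed_product]; a packing of larger value can be lowered to value
exactly [s] by [packable_leq], since an odd cycle minus a vertex is a disjoint
union of k edges).  So the inclusion of the symbolic power in the sum follows
once the least weight of a vertex cover is the value of some packing, for every
weight [w]: this is the property [konig].

It is proved along the construction of [G].
- An edge with positive ends that lies in no minimum cover can be put into the
  packing, as this lowers the minimum by exactly 1 ([konig_of_good_edges]).
  Here an edge lies in a cover when both of its ends do.
- On a bipartite graph, uncrossing minimum covers produces such an edge
  ([bipartite_good_edge]).
- On an odd cycle, a vertex of weight 0 reduces to the bipartite case.  If all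
  weights are positive and no good edge exists, then uncrossing shows that the
  alternating covers are all minimum, so that the weight is constant, and
  copies of the whole cycle are an optimal packing ([konig_odd_cycle]).
- For a clique-sum along [K], a vertex cover misses at most one vertex of [K].
  The weight on [K] can then be split between the two sides so that the minimum
  cover weights add up ([konig_clique_sum]).

Conversely, let [P = (I : f)] be any associated prime of the edge ideal [I].
Comparing with a monomial of [f] outside [I] shows that a variable in [P] has a
neighbour outside [P], hence lies in [I] locally at [P].  An odd cycle
contains a vertex in [P], and the rest of it splits into k edges, so its product
lies in the power k + 1 of [I] locally at [P] ([odd_cycle_saturation]). *)

Set Implicit Arguments.
Unset Strict Implicit.
Unset Printing Implicit Defensive.

(** * Vertex covers and their weights *)

Section Covers.
Variable V : finType.
Implicit Types (G H C : sgraph V) (D : {set V}) (m : V -> nat).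

Lemma edge_sub_vset G x y :
  [set x; y] \in edges G -> (x \in vset G) && (y \in vset G).
Proof.
move=> /(forall_inP (edgesP G)) /andP[/subsetP sub _].
by rewrite !sub // !inE eqxx ?orbT.
Qed.

Lemma edge_neq G x y : [set x; y] \in edges G -> x != y.
Proof.
by move=> /(forall_inP (edgesP G)) /andP[_]; rewrite cards2; case: (x != y).
Qed.

Definition vcover G D : bool :=
  [forall x, forall y, ([set x; y] \in edges G) ==> (x \in D) || (y \in D)].

Lemma vcoverP G D :
  reflect (forall x y, [set x; y] \in edges G -> (x \in D) || (y \in D))
          (vcover G D).
Proof.
apply: (iffP forallP) => [h x y|h x]; last by apply/forallP => y; apply/implyP/h.
by move: (h x) => /forallP/(_ y)/implyP.
Qed.

Lemma vcoverT G : vcover G setT.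
Proof. by apply/vcoverP => x y _; rewrite inE. Qed.

Lemma vcoverS G D D' : D \subset D' -> vcover G D -> vcover G D'.
Proof.
move=> /subsetP s /vcoverP h; apply/vcoverP => x y /h.
by case/orP => /s ->; rewrite ?orbT.
Qed.

Lemma vcoverD1 G D x : vcover G D ->
  (forall y, [set x; y] \in edges G -> y \in D) -> vcover G (D :\ x).
Proof.
move=> /vcoverP cD nbr; have key y : [set x; y] \in edges G -> y \in D :\ x.
  by move=> e; rewrite in_setD1 nbr // eq_sym (edge_neq e).
apply/vcoverP => y z e.
have [yx|yx] := eqVneq y x; first by subst y; rewrite (key z e) orbT.
have [zx|zx] := eqVneq z x; first by subst z; rewrite key // setUC.
by rewrite !in_setD1 yx zx; apply: cD.
Qed.

Definition wt m D : nat := \sum_x (x \in D) * m x.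

Lemma leq_wt m m' D D' :
  (forall x, (x \in D) * m x <= (x \in D') * m' x) -> wt m D <= wt m' D'.
Proof. by move=> h; apply: leq_sum. Qed.

Lemma eq_wt m m' D : m =1 m' -> wt m D = wt m' D.
Proof. by move=> h; apply: eq_bigr => x _; rewrite h. Qed.

Lemma wtD m m' D : wt (fun x => m x + m' x) D = wt m D + wt m' D.
Proof. by rewrite -big_split; apply: eq_bigr => x _; rewrite mulnDr. Qed.

Lemma wt_pred1 y D : wt (fun x => x == y) D = (y \in D).
Proof.
rewrite /wt (bigD1 y) //= eqxx muln1 big1 ?addn0 // => x /negPf ->.
by rewrite muln0.
Qed.

Lemma wtU1 m D x : x \notin D -> wt m (x |: D) = m x + wt m D.
Proof.
move=> xD; rewrite /wt (bigD1 x) //= [in RHS](bigD1 x) //= setU11 (negPf xD).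
rewrite mul1n mul0n add0n; congr (_ + _); apply: eq_bigr => y yx.
by rewrite in_setU1 (negPf yx).
Qed.

Lemma wtD1 m D x : x \in D -> wt m D = m x + wt m (D :\ x).
Proof. by move=> xD; rewrite -wtU1 ?setD1K // !inE eqxx. Qed.

(** The weighted vertex cover number. *)
Definition tau G m : nat :=
  wt m [arg min_(D < setT | vcover G D) wt m D].

Lemma tauP G m : exists2 D, vcover G D & wt m D = tau G m.
Proof.
rewrite /tau; case: arg_minnP => [|D cD _]; first exact: vcoverT.
by exists D.
Qed.

Lemma tau_le G m D : vcover G D -> tau G m <= wt m D.
Proof.
by rewrite /tau; case: arg_minnP => [|D' _ min /min //]; apply: vcoverT.
Qed.

Definition min_vcover G m D := vcover G D && (wt m D == tau G m).

Lemma min_vcoverP G m D : vcover G D -> wt m D <= tau G m -> min_vcover G m D.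
Proof. by move=> cD le; rewrite /min_vcover cD eqn_leq le tau_le. Qed.

(** * Packings by edges and induced odd cycles *)

(** [packable G m s]: the weight [m] dominates a sum of indicator functions of
edges (value 1 each) and of induced odd cycles on 2n + 1 vertices (value n + 1
each), with total value [s].  The inequalities between weights avoid truncated
subtraction. *)
Inductive packable G : (V -> nat) -> nat -> Prop :=
| PackNil m : packable G m 0
| PackEdge m m' s x y : [set x; y] \in edges G -> packable G m' s ->
    (forall z, m' z + ((z == x) + (z == y)) <= m z) -> packable G m s.+1
| PackCycle m m' s n C : induced_cycle n.*2.+1 G C -> packable G m' s ->
    (forall z, m' z + (z \in vset C) <= m z) -> packable G m (s + n.+1).

Lemma packable_mono G m m' s :
  packable G m s -> (forall x, m x <= m' x) -> packable G m' s.
Proof.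
move=> pk; elim: pk m' => {m s} [m|m m1 s x y e pk IH le|m m1 s n C iC pk IH le] m' le'.
- exact: PackNil.
- by apply: (PackEdge e pk) => z; apply: leq_trans (le z) _.
- by apply: (PackCycle iC pk) => z; apply: leq_trans (le z) _.
Qed.

Lemma packableD G m1 m2 s1 s2 :
  packable G m1 s1 -> packable G m2 s2 ->
  packable G (fun x => m1 x + m2 x) (s1 + s2).
Proof.
move=> pk1 pk2; elim: pk1 => {m1 s1} [m|m m1 s x y e _ IH le|m m1 s n C iC _ IH le].
- by apply: packable_mono pk2 _ => x; apply: leq_addl.
- by rewrite addSn; apply: PackEdge e IH _ => z; move: (le z); lia.
- by rewrite addnAC; apply: PackCycle iC IH _ => z; move: (le z); lia.
Qed.

Lemma induced_subgraph_trans H G C :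
  induced_subgraph C H -> induced_subgraph H G -> induced_subgraph C G.
Proof.
move=> [sCH eC] [sHG eH]; split; first exact: subset_trans sHG.
rewrite eC eH; apply/setP => e; rewrite !inE -andbA; congr (_ && _).
by apply: andb_idl => s; apply: subset_trans sCH.
Qed.

Lemma packable_induced H G m s :
  induced_subgraph H G -> packable H m s -> packable G m s.
Proof.
move=> iH pk; elim: pk => {m s} [m|m m1 s x y e _ IH le|m m1 s n C [iC cC] _ IH le].
- exact: PackNil.
- by apply: PackEdge IH le; move: e; rewrite iH.2 inE => /andP[].
- apply: PackCycle IH le; split; last exact: cC.
  exact: induced_subgraph_trans iH.
Qed.

(** Weighted duality between vertex covers and packings. *)
Definition konig G := forall m, packable G m (tau G m).

Definition good_edge G m x y : bool :=
  [&& [set x; y] \in edges G, 0 < m x, 0 < m y &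
      [forall D : {set V}, min_vcover G m D ==> ~~ ((x \in D) && (y \in D))]].

(** Removing a good edge from the weight lowers every minimum cover by exactly 1
and every other cover by at most 2, so the minimum drops by exactly 1. *)
Lemma konig_of_good_edges G :
  (forall m, 0 < tau G m ->
     (exists x y, good_edge G m x y) \/ packable G m (tau G m)) ->
  konig G.
Proof.
move=> good m; move Ek: (tau G m) => k.
elim: k m Ek => [|k IH] m Em; first exact: PackNil.
have [|[x [y /and4P[exy mx my /forall_inP gd]]]|] := good m; rewrite ?Em //.
pose m' z := m z - ((z == x) + (z == y)).
have nxy := edge_neq exy.
have mE z : m z = m' z + ((z == x) + (z == y)).
  rewrite /m' subnK //; case: eqP => [->|_]; last by case: eqP => [->|].
  by rewrite (negPf nxy) addn0.
have wE D : wt m D = wt m' D + ((x \in D) + (y \in D)).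
  by rewrite (eq_wt _ mE) !wtD !wt_pred1.
apply: (PackEdge exy (IH m' _)) => [|z]; last by rewrite mE.
apply/eqP; rewrite eqn_leq; apply/andP; split.
  have [D cD wD] := tauP G m; move: (tau_le m' cD) (vcoverP _ _ cD _ _ exy).
  by move: (wE D); rewrite wD Em; case: (x \in D) (y \in D) => [] []; lia.
have [D cD <-] := tauP G m'; move: (tau_le m cD) (gd D); rewrite /min_vcover cD Em wE /=.
by case: (x \in D) (y \in D) => [] [] /=; lia.
Qed.

(** A vertex [x] of positive weight without a private neighbour could be traded
for the vertices of weight 0, giving a lighter cover. *)
Lemma min_vcover_irredundant G m D x : min_vcover G m D -> x \in D -> 0 < m x ->
  exists y, [/\ [set x; y] \in edges G, y \notin D & 0 < m y].
Proof.
move=> /andP[cD /eqP wD] xD mx.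
have [/existsP[y /and3P[e yD my]]|none] :=
  boolP [exists y, [&& [set x; y] \in edges G, y \notin D & 0 < m y]].
  by exists y.
pose Z := D :|: [set y | m y == 0].
have cZ : vcover G (Z :\ x).
  apply: vcoverD1 (vcoverS (subsetUl _ _) cD) _ => y e.
  move: none; rewrite negb_exists => /forallP/(_ y); rewrite e /= !inE.
  by rewrite negb_and negbK -leqNgt leqn0.
have := tau_le m cZ; rewrite -wD (wtD1 m xD).
have -> : wt m (Z :\ x) = wt m (D :\ x).
  apply: eq_bigr => y _; rewrite !inE; case: (m y =P 0) => [->|_].
    by rewrite !muln0.
  by rewrite orbF.
by rewrite -{2}[wt _ _]add0n leq_add2r leqNgt mx.
Qed.

(** * Bipartite graphs *)

(** Bipartiteness is only asked of the vertices of positive weight, so that the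
lemma also covers an odd cycle with a vertex of weight 0.

Take a minimum cover [D] that contains a vertex [v] outside [A] of positive
weight and has the largest trace on [A].  As [v] cannot be dropped, it has a
neighbour [u] outside [D].  A minimum cover with both [v] and [u] would, joined
with [D] on [A] and met with [D] outside [A], give a minimum cover containing
[v] with a larger trace on [A]. *)
Lemma bipartite_good_edge G m (A : {set V}) :
  (forall x y, [set x; y] \in edges G -> 0 < m x -> 0 < m y ->
     (x \in A) != (y \in A)) ->
  0 < tau G m -> exists x y, good_edge G m x y.
Proof.
move=> bip t0.
(* up to exchanging the sides, the vertex v lies outside B *)
have step (B : {set V}) (v : V) (D0 : {set V}) :
     (forall x y, [set x; y] \in edges G -> 0 < m x -> 0 < m y ->
     (x \in B) != (y \in B)) -> min_vcover G m D0 -> v \in D0 -> v \notin B ->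
     0 < m v -> exists x y, good_edge G m x y.
  move=> bipB mD0 vD0 vB mv.
  pose Q D := min_vcover G m D && (v \in D).
  have Q0 : Q D0 by rewrite /Q mD0.
  case: (arg_maxnP (fun D : {set V} => #|D :&: B|) Q0) => D /andP[mD vD] max.
  have [u [e uD mu]] := min_vcover_irredundant mD vD mv.
  have uB : u \in B by move: (bipB _ _ e mv mu); rewrite (negPf vB); case: (u \in B).
  exists v, u; apply/and4P; split=> //.
  apply/forall_inP => D' mD'; apply/negP => /andP[vD' uD'].
  (* vertices of weight 0 are free, and adding them all makes the uncrossed
     sets covers although edges at such vertices may violate bipartiteness *)
  pose Z := [set x | m x == 0].
  pose U := Z :|: ((D :|: D') :&: B) :|: ((D :&: D') :\: B).
  pose W := Z :|: ((D :|: D') :\: B) :|: ((D :&: D') :&: B).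
  have [/andP[cD /eqP wD] /andP[cD' /eqP wD']] := (mD, mD').
  have cU : vcover G U.
    apply/vcoverP => x y exy; move: (bipB _ _ exy); rewrite !lt0n.
    move: (vcoverP _ _ cD _ _ exy) (vcoverP _ _ cD' _ _ exy); rewrite !inE.
    move: (m x == 0) (m y == 0) (x \in D) (y \in D) (x \in D') (y \in D').
    move: (x \in B) (y \in B).
    by do 8!case => //=; move=> _ _ /(_ isT isT).
  have cW : vcover G W.
    apply/vcoverP => x y exy; move: (bipB _ _ exy); rewrite !lt0n.
    move: (vcoverP _ _ cD _ _ exy) (vcoverP _ _ cD' _ _ exy); rewrite !inE.
    move: (m x == 0) (m y == 0) (x \in D) (y \in D) (x \in D') (y \in D').
    move: (x \in B) (y \in B).
    by do 8!case => //=; move=> _ _ /(_ isT isT).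
  have wUW : wt m U + wt m W = wt m D + wt m D'.
    rewrite -!big_split; apply: eq_bigr => x _ /=; rewrite -!mulnDl !inE.
    case: (m x =P 0) => [->|_]; first by rewrite !muln0.
    by congr (_ * _); case: (x \in B); case: (x \in D); case: (x \in D').
  have QU : Q U.
    apply/andP; split; last by rewrite !inE vD vD' vB !orbT.
    apply: min_vcoverP => //.
    by rewrite -(leq_add2r (wt m W)) wUW wD wD' leq_add2l tau_le.
  have := max _ QU; rewrite /= leqNgt => /negP; apply; apply: proper_card.
  rewrite properE; apply/andP; split.
    by apply/subsetP => x; rewrite !inE => /andP[-> ->]; rewrite !orbT.
  by apply/subsetPn; exists u; rewrite !inE ?uB ?uD' ?(negPf uD) ?orbT.
have [D cD wD] := tauP G m.
have mD : min_vcover G m D by rewrite /min_vcover cD wD eqxx.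
have [v vD mv] : exists2 v, v \in D & 0 < m v.
  move: t0; rewrite -wD lt0n sum_nat_eq0 => /forallPn[v].
  rewrite /= muln_eq0 negb_or eqb0 negbK -lt0n => /andP[vD mv].
  by exists v.
have [vA|vA] := boolP (v \in A); last exact: step bip mD vD vA mv.
apply: (step (~: A) v D) => // [x y e mx my|]; last by rewrite inE vA.
by move: (bip _ _ e mx my); rewrite !inE; do 2!case: (_ \in A).
Qed.

Lemma konig_bipartite G : bipartite G -> konig G.
Proof.
case=> A [B [dAB _ eAB]]; apply: konig_of_good_edges => m t0; left.
apply: (@bipartite_good_edge _ _ A) t0 => x y /eAB [a [b [aA bB E]]] _ _.
have bA : (b \in A) = false by apply: (disjointFl dAB).
have : a \in [set x; y] by rewrite E !inE eqxx.
have : b \in [set x; y] by rewrite E !inE eqxx orbT.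
rewrite !inE => /orP hb /orP ha; apply/eqP => xyA.
by case: hb ha bA aA => /eqP -> [] /eqP ->; rewrite ?xyA => ->.
Qed.

(** * Odd cycles *)

(** The vertices in cyclic order, indexed by all natural numbers so that neighbours
are plain successors and the starting point can be shifted. *)
Definition cyclic_walk N G (g : nat -> V) : Prop :=
  [/\ forall i j, (g i == g j) = (i == j %[mod N]),
      vset G = [set g i | i : 'I_N],
      forall i, [set g i; g i.+1] \in edges G &
      forall x y, [set x; y] \in edges G ->
        exists2 i, i < N & [set x; y] = [set g i; g i.+1]].

Lemma cyclic_walk_exists N G : is_cycle N G -> exists g, cyclic_walk N G g.
Proof.
case: N => [[]//|N] [_ [f [finj vE eE]]].
pose g i : V := f (inord (i %% N.+1)).
have ltN i : i %% N.+1 < N.+1 by rewrite ltn_mod.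
have gE (i : 'I_N.+1) : g i = f i.
  by rewrite /g modn_small // inord_val.
have gS i : g i.+1 = f (ordS (inord (i %% N.+1))).
  congr f; apply/val_inj; rewrite /= !inordK //.
  by rewrite -[in RHS]addn1 modnDml addn1.
exists g; split.
- move=> i j; rewrite (inj_eq finj); apply/eqP/eqP => [|->//].
  by move/(congr1 val); rewrite /= !inordK.
- by rewrite vE; apply: eq_imset => i; rewrite gE.
- by move=> i; rewrite gS eE; apply: imset_f.
- move=> x y; rewrite eE => /imsetP[i _ ->]; exists i => //.
  by rewrite gS gE modn_small // inord_val.
Qed.

Lemma cyclic_walk_succ N G g i j :
  cyclic_walk N G g -> g i = g j -> g i.+1 = g j.+1.
Proof.
move=> [geq _ _ _] /eqP; rewrite geq => /eqP E; apply/eqP.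
by rewrite geq -addn1 -[j.+1]addn1 eqn_modDr E.
Qed.

Lemma cyclic_walk_shift N G g k :
  0 < N -> cyclic_walk N G g -> cyclic_walk N G (fun i => g (i + k)).
Proof.
move=> N0 wg; have [geq vE ge eg] := wg.
have gmod i : exists2 j, j < N & g i = g (j + k).
  exists ((i + N.-1 * k) %% N); first by rewrite ltn_mod.
  apply/eqP; rewrite geq modnDml -addnA -mulSnr prednK //.
  by rewrite addnC mulnC modnMDl.
split=> [i j|||x y].
- by rewrite geq eqn_modDr.
- rewrite vE; apply/setP => x; apply/imsetP/imsetP => -[i _ ->].
    by have [j jN ->] := gmod i; exists (Ordinal jN).
  exists (Ordinal (ltn_pmod (i + k) N0)) => //; apply/eqP.
  by rewrite geq /= modn_mod.
- by move=> i; apply: ge.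
- move=> /eg[i _ ->]; have [j jN E] := gmod i; exists j => //.
  by rewrite addSn E; congr [set _; _]; apply: cyclic_walk_succ wg E.
Qed.

Lemma cyclic_walk_inj N G g i j : cyclic_walk N G g -> i < N -> j < N ->
  (g i == g j) = (i == j).
Proof. by move=> [-> _ _ _] iN jN; rewrite !modn_small. Qed.

Lemma cyclic_walk_N N G g i : cyclic_walk N G g -> g (i + N) = g i.
Proof. by move=> [geq _ _ _]; apply/eqP; rewrite geq modnDr. Qed.

(** Leaving out the last vertex of the walk, the others pair up into n edges. *)
Lemma packable_near_cycle n G C : induced_cycle n.*2.+1 G C ->
  packable G (fun z => z \in vset C) n.
Proof.
move=> [iC cC]; have [g wg] := cyclic_walk_exists cC; have [_ vE ge _] := wg.
apply: packable_induced iC _.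
suff H k : packable C (fun z => count_mem z (map g (iota 0 k.*2))) k.
  apply: packable_mono (H n) _ => z; rewrite count_uniq_mem.
    case: (boolP (z \in map g _)) => [|//]; rewrite vE => /mapP[i]; rewrite mem_iota => iN ->.
    have iN' : i < n.*2.+1 by lia.
    suff -> : g i \in [set g i | i : 'I_n.*2.+1] by [].
    by apply/imsetP; exists (Ordinal iN').
  rewrite map_inj_in_uniq ?iota_uniq // => i j; rewrite !mem_iota => iN jN /eqP.
  by rewrite (cyclic_walk_inj wg) ?[_ < _]ltnS; [move/eqP|lia|lia].
elim: k => [|k IH]; first exact: PackNil.
apply: PackEdge (ge k.*2) IH _ => z.
rewrite doubleS -(addn2 k.*2) iotaD map_cat count_cat /= addn0 add0n.
by rewrite ![z == _]eq_sym.
Qed.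

(** Lowering the value by 1 deletes an edge, or replaces a cycle of value n + 1 by
n disjoint edges of it. *)
Lemma packable_leq G m s s' : s' <= s -> packable G m s -> packable G m s'.
Proof.
move=> /subnK <-; elim: (s - s') => [//|d IH]; rewrite addSn => pk; apply: IH.
move: pk; move: (d + s') => k; move Ek: k.+1 => k1 pk.
case: pk Ek => {m k1} [//|m m1 k1 x y _ pk le [->]|m m1 k1 l C iC pk le].
  by apply: packable_mono pk _ => z; apply: leq_trans (le z); apply: leq_addr.
rewrite addnS => -[->]; have := packableD pk (packable_near_cycle iC).
by move=> h; apply: packable_mono h _ => z; apply: le.
Qed.
Section OddCycle.
Variables (n : nat) (G : sgraph V).
Let N := n.*2.+1.
Hypothesis n_gt0 : 0 < n.
Implicit Types (g : nat -> V).

Lemma cyclic_walk_cover g D : cyclic_walk N G g ->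
  (forall i, i < N -> (g i \in D) || (g i.+1 \in D)) -> vcover G D.
Proof.
move=> [_ _ _ eg] h; apply/vcoverP => x y /eg[i /h gD E].
have : g i \in [set x; y] by rewrite E !inE eqxx.
have : g i.+1 \in [set x; y] by rewrite E !inE eqxx orbT.
rewrite !inE => /orP[]/eqP E1 /orP[]/eqP E2; move: gD; rewrite E1 E2 ?orbb.
- by move=> ->.
- by rewrite orbC.
- by [].
- by move=> ->; rewrite orbT.
Qed.

Lemma cyclic_walk_nbr g i y : cyclic_walk N G g ->
  [set g i.+1; y] \in edges G -> (y == g i) || (y == g i.+2).
Proof.
move=> wg e; have [_ _ _ eg] := wg; have [j _ E] := eg _ _ e.
have nxy := edge_neq e.
have : y \in [set g j; g j.+1] by rewrite -E !inE eqxx orbT.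
have : g i.+1 \in [set g j; g j.+1] by rewrite -E !inE eqxx.
rewrite !inE => /orP[]/eqP E1 /orP[]/eqP E2; rewrite ?E1 ?E2 ?eqxx.
- by move: nxy; rewrite E1 E2 eqxx.
- by rewrite (cyclic_walk_succ wg E1) eqxx orbT.
- have [geq _ _ _] := wg; move/eqP: E1; rewrite geq -addn1 -[j.+1]addn1 eqn_modDr.
  by rewrite -geq eq_sym => ->.
- by move: nxy; rewrite E1 E2 eqxx.
Qed.

(** The middle one of three consecutive vertices would have no private
neighbour. *)
Lemma min_vcover_consecutive g m D i : cyclic_walk N G g -> min_vcover G m D ->
  0 < m (g i.+1) -> g i \in D -> g i.+1 \in D -> g i.+2 \notin D.
Proof.
move=> wg mD mi gi gi1; apply/negP => gi2.
have [y [e yD my]] := min_vcover_irredundant mD gi1 mi.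
by case/orP: (cyclic_walk_nbr wg e) yD => /eqP ->; rewrite ?gi ?gi2.
Qed.

(** Walk from vertex 1, which lies in [D'] but not in [D], as long as each vertex
lies in only one of the two covers: they then alternate.  If the walk stopped
before coming round, both covers would contain the next vertex, and exchanging
them on the walked segment would produce two minimum covers, one of them
containing the consecutive vertices 2n, 0 and 1. *)
Lemma min_vcover_alternate g m D D' : cyclic_walk N G g ->
    (forall i, 0 < m (g i)) -> min_vcover G m D -> min_vcover G m D' ->
    g n.*2 \in D -> g 0 \in D -> g 0 \in D' -> g 1 \in D' ->
  forall k, 0 < k <= n.*2 -> (g k \in D = ~~ odd k) /\ (g k \in D' = odd k).
Proof.
move=> wg mpos mD mD' D2n D0 D'0 D'1.
(* vertex 2n + 1 is vertex 0 again *)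
have gN : g n.*2.+1 = g 0 by rewrite -[n.*2.+1]add0n (cyclic_walk_N 0 wg).
have gN1 : g n.*2.+2 = g 1 by rewrite -[n.*2.+2]add1n (cyclic_walk_N 1 wg).
have not3 E : min_vcover G m E -> g n.*2 \in E -> g 0 \in E -> g 1 \notin E.
  move=> mE e1 e2; rewrite -gN1; apply: min_vcover_consecutive wg mE _ e1 _ => //.
  by rewrite gN.
have [/andP[cD /eqP wD] /andP[cD' /eqP wD']] := (mD, mD').
have [_ _ ge _] := wg.
have cov E i : vcover G E -> (g i \in E) || (g i.+1 \in E).
  by move=> /vcoverP; apply.
suff H k : 0 < k <= n.*2 -> forall j, 0 < j <= k ->
    (g j \in D = ~~ odd j) /\ (g j \in D' = odd j).
  by move=> k k2; apply: (H k) => //; case/andP: k2 => ->; rewrite leqnn.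
elim: k => [//|k IH] k2 j jk.
have [jk'|jk'] := boolP (j <= k); first by apply: IH; move: k2 jk jk'; clear; lia.
have {jk jk'} -> : j = k.+1 by move: jk jk'; clear; lia.
have [k0|k0] := posnP k.
  by rewrite k0 (negPf (not3 _ mD D2n D0)) D'1.
have IHk : forall j, 0 < j <= k ->
    (g j \in D = ~~ odd j) /\ (g j \in D' = odd j) by apply: IH; move: k2 k0; clear; lia.
suff nboth : ~~ ((g k.+1 \in D) && (g k.+1 \in D')).
  have [Dk D'k] := IHk k ltac:(by rewrite k0 leqnn).
  move: (cov D k cD) (cov D' k cD') nboth; rewrite Dk D'k /=.
  by case: (odd k) (g k.+1 \in D) (g k.+1 \in D') => [] [] [].
apply/negP => /andP[Dk D'k].
pose S := [set x | x \in map g (iota 1 k)].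
have inS i : i < N -> (g i \in S) = (0 < i <= k).
  move=> iN; rewrite inE; apply/mapP/idP => [[l]|ik].
    rewrite mem_iota add1n ltnS => lk /eqP; rewrite (cyclic_walk_inj wg) //.
      by move=> /eqP ->.
    by move: lk k2; rewrite /N; clear; lia.
  by exists i; rewrite // mem_iota add1n ltnS.
pose D1 := (D :\: S) :|: (D' :&: S); pose D2 := (D' :\: S) :|: (D :&: S).
have in1 i : i < N -> (g i \in D1) = if 0 < i <= k then g i \in D' else g i \in D.
  by move=> iN; rewrite /D1 in_setU in_setD in_setI inS //; case: ifP;
    rewrite /= ?andbT ?andbF ?orbF.
have in2 i : i < N -> (g i \in D2) = if 0 < i <= k then g i \in D else g i \in D'.
  by move=> iN; rewrite /D2 in_setU in_setD in_setI inS //; case: ifP;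
    rewrite /= ?andbT ?andbF ?orbF.
(* on the boundary of S both covers contain the outer end, g 0 or g k.+1 *)
have cover12 (E E' F : {set V}) : vcover G E -> vcover G E' -> g 0 \in E -> g 0 \in E' ->
    g k.+1 \in E -> g k.+1 \in E' ->
    (forall i, i < N -> (g i \in F) = if 0 < i <= k then g i \in E' else g i \in E) ->
    vcover G F.
  move=> cE cE' E0 E'0 Ek E'k inF; apply: cyclic_walk_cover wg _ => i iN.
  have [i2n|i2n] := boolP (i == n.*2).
    by rewrite (eqP i2n) gN (inF 0) //= E0 orbT.
  rewrite !inF //; last by move: iN i2n; rewrite /N; clear; lia.
  move: (cov E i cE) (cov E' i cE').
  have [->|i0] := posnP i; first by rewrite /= E0.
  have [->|ik] := eqVneq i k; first by rewrite Ek E'k leqnn ltnn /= orbT.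
  have -> : (0 < i.+1 <= k) = (i <= k) by move: ik; clear; lia.
  by case: (i <= k).
have c1 : vcover G D1 by apply: (cover12 D D').
have c2 : vcover G D2 by apply: (cover12 D' D).
have w12 : wt m D1 + wt m D2 = wt m D + wt m D'.
  rewrite -!big_split; apply: eq_bigr => x _ /=; rewrite -!mulnDl !in_setU !in_setD !in_setI.
  by congr (_ * _); case: (x \in S); case: (x \in D); case: (x \in D').
have mD1 : min_vcover G m D1.
  apply: min_vcoverP => //.
  by rewrite -(leq_add2r (wt m D2)) w12 wD wD' leq_add2l tau_le.
have := not3 _ mD1; rewrite !in1 //; last by rewrite /N; move: n_gt0; clear; lia.
rewrite D0 D'1 k0 /=; have -> : 0 < n.*2 <= k = false by move: k2; clear; lia.
by move/(_ D2n isT).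
Qed.

Lemma packable_cycle c : is_cycle N G ->
  packable G (fun z => c * (z \in vset G)) (c * n.+1).
Proof.
move=> cG; elim: c => [|c IH]; first exact: PackNil.
rewrite mulSn addnC; apply: (@PackCycle _ _ (fun z => c * (z \in vset G))) IH _.
  split; last exact: cG; split=> //; apply/setP => e; rewrite inE.
  by apply/idP/andP => [eG|[]//]; split=> //; case/andP: (forall_inP (edgesP G) e eG).
by move=> z; rewrite mulSn addnC.
Qed.

(** If every edge lies in a minimum cover, then by [min_vcover_alternate] the
alternating cover doubled at any edge is minimum.  Moving its first vertex one
step forward gives the alternating cover doubled two edges further on, so
weights do not decrease along the cycle and are constant. *)
Lemma konig_odd_cycle : is_cycle N G -> konig G.
Proof.
move=> cG; have [g wg] := cyclic_walk_exists cG; have [geq vE ge eg] := wg.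
have N0 : 0 < N by [].
apply: konig_of_good_edges => m t0.
have [/existsP[x /existsP[y good]]|nogood] := boolP [exists x, exists y, good_edge G m x y].
  by left; exists x, y.
have [/exists_inP[v vG mv]|mpos] := boolP [exists v in vset G, m v == 0].
  left; move: vG; rewrite vE => /imsetP[i _ vi]; pose h j := g (j + i).
  have wh : cyclic_walk N G h by apply: cyclic_walk_shift.
  have h0 : m (h 0) = 0 by rewrite /h add0n -vi (eqP mv).
  pose A := [set x | [exists j : 'I_N, odd j && (x == h j)]].
  have inA j : j < N -> (h j \in A) = odd j.
    move=> jN; rewrite inE; apply/existsP/idP => [[l /andP[ol]]|oj].
      by rewrite (cyclic_walk_inj wh) // => /eqP ->.
    by exists (Ordinal jN); rewrite /= oj eqxx.
  apply: (@bipartite_good_edge _ _ A) t0 => x y e mx my.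
  have [_ _ _ eh] := wh; have [j jN E] := eh _ _ e.
  have hjA : (h j \in A) != (h j.+1 \in A).
    have mh z : z \in [set x; y] -> 0 < m z by rewrite !inE => /orP[]/eqP ->.
    have mj1 : 0 < m (h j.+1) by apply: mh; rewrite E !inE eqxx orbT.
    have jN1 : j.+1 < N.
      rewrite ltn_neqAle jN andbT; apply: contraTneq mj1 => ->.
      by rewrite -[N]add0n (cyclic_walk_N 0 wh) h0.
    by rewrite !inA //=; case: (odd j).
  have : x \in [set h j; h j.+1] by rewrite -E !inE eqxx.
  have : y \in [set h j; h j.+1] by rewrite -E !inE eqxx orbT.
  have := edge_neq e; rewrite !in_set2 => nxy.
  move=> /orP[]/eqP yE /orP[]/eqP xE; move: nxy hjA; rewrite xE yE ?eqxx //.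
  by move=> _; rewrite eq_sym.
right.
have mg i : 0 < m (g i).
  rewrite lt0n; apply: contra mpos => mi; apply/exists_inP; exists (g i) => //.
  by case/andP: (edge_sub_vset (ge i)).
have bad i : exists D, [/\ min_vcover G m D, g i \in D & g i.+1 \in D].
  move: nogood; rewrite negb_exists => /forallP/(_ (g i)).
  rewrite negb_exists => /forallP/(_ (g i.+1)).
  rewrite /good_edge ge !mg /= => /forall_inPn[D mD].
  by rewrite negbK => /andP[gi gi1]; exists D.
(* replace g i by g i.+1 in the alternating cover starting at g i *)
have mono i : m (g i) <= m (g i.+1).
  pose h j := g (j + i).
  have wh : cyclic_walk N G h by apply: cyclic_walk_shift.
  have [D [mD D2n DN]] := bad (n.*2 + i).
  have [D' [mD' D'0 D'1]] := bad i.
  have D0 : h 0 \in D by rewrite -(cyclic_walk_N 0 wh) add0n /h /N addSn.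
  have alt := min_vcover_alternate wh (fun j => mg _) mD mD' D2n D0 D'0 D'1.
  have h1D : h 1 \notin D by rewrite (alt 1 _).1 //= double_gt0.
  have cE : vcover G (h 1 |: (D :\ h 0)).
    apply: (cyclic_walk_cover wh) => j jN; rewrite !in_setU1 !in_setD1.
    have [->|j0] := posnP j; first by rewrite (eqxx (h 1)) orbT.
    have [->|j1] := eqVneq j 1; first by rewrite (eqxx (h 1)).
    have hj0 : h j != h 0 by rewrite (cyclic_walk_inj wh) // -lt0n.
    have [jE|j2n] := eqVneq j n.*2.
      by rewrite hj0 jE [h _ \in D]D2n orbT.
    have j1N : j.+1 < N by move: jN j2n; rewrite /N; clear; lia.
    have hj1 : h j.+1 != h 0 by rewrite (cyclic_walk_inj wh).
    have [Dj _] := alt j ltac:(by rewrite j0).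
    have [Dj1 _] := alt j.+1 j1N.
    by rewrite hj0 hj1 Dj Dj1 /=; case: (odd j); rewrite ?orbT.
  case/andP: mD => _ /eqP wD; have := tau_le m cE.
  have nh1 : h 1 \notin D :\ h 0 by rewrite in_setD1 negb_and h1D orbT.
  rewrite (wtU1 _ nh1) -wD (wtD1 m D0) leq_add2r.
  by [].
have mono2 i k : m (g i) <= m (g (i + k)).
  elim: k => [|k IH]; first by rewrite addn0.
  by rewrite addnS; apply: leq_trans IH (mono _).
have mc i : m (g i) = m (g 0).
  apply/eqP; rewrite eqn_leq -{2}[i]add0n mono2 andbT.
  have /eqP <- : g (i + n.*2 * i) == g 0 by rewrite geq -mulSn mod0n modnMr.
  exact: mono2.
set c := m (g 0) in mc.
suff tc : tau G m <= c * n.+1.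
  apply: packable_leq tc _; apply: packable_mono (packable_cycle c cG) _ => z.
  have [zG|_] := boolP (z \in vset G); last by rewrite muln0.
  by move: zG; rewrite vE => /imsetP[i _ ->]; rewrite mc muln1.
(* the alternating cover has n.+1 vertices, as many as the value of a cycle *)
pose D := [set g k.*2 | k : 'I_n.+1].
have cD : vcover G D.
  apply: cyclic_walk_cover wg _ => i iN.
  have [oi|oi] := boolP (odd i).
    have h : i.+1./2 < n.+1 by move: iN; rewrite /N; clear; lia.
    apply/orP; right; apply/imsetP; exists (Ordinal h) => //=.
    by rewrite uphalfK oi.
  have h : i./2 < n.+1 by move: iN; rewrite /N; clear; lia.
  apply/orP; left; apply/imsetP; exists (Ordinal h) => //=.
  by rewrite halfK (negPf oi) subn0.
apply: leq_trans (tau_le m cD) _.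
have -> : wt m D = #|D| * c.
  rewrite -sum_nat_const [RHS]big_mkcond; apply: eq_bigr => x _.
  case: (boolP (x \in D)) => [/imsetP[k _ ->]|//]; by rewrite mc mul1n.
by rewrite mulnC leq_mul2l -[n.+1]card_ord leq_imset_card orbT.
Qed.

End OddCycle.

(** * Clique-sums *)

Lemma gunionC G H : gunion G H = gunion H G.
Proof.
rewrite /gunion; move: (gunion_subproof G H) (gunion_subproof H G).
by rewrite [edges G :|: _]setUC [vset G :|: _]setUC => p q; rewrite (bool_irrelevance p q).
Qed.

Lemma ginterC G H : ginter G H = ginter H G.
Proof.
rewrite /ginter; move: (ginter_subproof G H) (ginter_subproof H G).
by rewrite [edges G :&: _]setIC [vset G :&: _]setIC => p q; rewrite (bool_irrelevance p q).
Qed.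

(** An edge of [G2] between vertices of [G1] lies in the common clique. *)
Lemma clique_sum_induced G1 G2 (K : {set V}) :
  ginter G1 G2 = complete K -> induced_subgraph G1 (gunion G1 G2).
Proof.
move=> GK; split=> /=; first exact: subsetUl.
have vK : vset G1 :&: vset G2 = K by have := congr1 (@vset V) GK.
have eK := congr1 (@edges V) GK.
apply/setP => e; rewrite !inE; apply/idP/idP => [e1|].
  by rewrite e1 /=; case/andP: (forall_inP (edgesP G1) e e1).
case/andP => /orP[//|e2] s1.
have /andP[s2 c2] := forall_inP (edgesP G2) e e2.
have : e \in edges (complete K) by rewrite inE c2 -vK subsetI s1 s2.
by rewrite -eK inE => /andP[].
Qed.

(** A vertex cover misses at most one vertex of the clique [K].  Let [D0] be the
lightest cover of [G1] outside [K] among those containing [K], and [D1 x] among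
those missing [x].  Giving [x] in [K] the weight [wt o1 (D1 x) - wt o1 D0] in
[G1], or all of its weight if that is less, makes covers of [G1] missing [x] no
cheaper than those containing [K]; the remaining weight goes to [G2]. *)
Lemma konig_clique_sum G1 G2 G :
  clique_sum G1 G2 G -> konig G1 -> konig G2 -> konig G.
Proof.
move=> [K [_ GK _ _ ->]] k1 k2 m.
have i1 : induced_subgraph G1 (gunion G1 G2) := clique_sum_induced GK.
have i2 : induced_subgraph G2 (gunion G1 G2).
  by rewrite gunionC; apply: clique_sum_induced; rewrite ginterC; apply: GK.
have vK : vset G1 :&: vset G2 = K by have := congr1 (@vset V) GK.
have eK x y : x \in K -> y \in K -> x != y ->
    ([set x; y] \in edges G1) && ([set x; y] \in edges G2).
  move=> xK yK nxy; have : [set x; y] \in edges (complete K).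
    by rewrite inE cards2 nxy subUset !sub1set xK yK.
  by rewrite -GK inE.
have KD G' D x : (G' = G1 \/ G' = G2) -> vcover G' D -> x \in K -> x \notin D -> K \subset x |: D.
  move=> oG /vcoverP cD xK xD; apply/subsetP => y yK; rewrite !inE.
  have [//|nyx] := eqVneq y x; have /andP[e1 e2] := eK y x yK xK nyx.
  by case: oG cD => -> /(_ y x); rewrite ?e1 ?e2 (negPf xD) orbF; apply.
(* the part of m that G1 keeps however the weight of K is split *)
pose o1 z := (z \in vset G1 :\: K) * m z.
have o1K z : z \in K -> o1 z = 0 by rewrite /o1 inE => ->.
pose D0 := [arg min_(D < setT | vcover G1 D && (K \subset D)) wt o1 D].
have [cD0 KD0 min0] : [/\ vcover G1 D0, K \subset D0 &
    forall D, vcover G1 D -> K \subset D -> wt o1 D0 <= wt o1 D].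
  rewrite /D0; case: arg_minnP => [|D /andP[cD sD] h].
    by rewrite vcoverT subsetT.
  by split=> // D' c' s'; apply: h; rewrite c'.
pose D1 x := [arg min_(D < setT :\ x | vcover G1 D && (x \notin D)) wt o1 D].
have D1P x : [/\ vcover G1 (D1 x), x \notin D1 x &
    forall D, vcover G1 D -> x \notin D -> wt o1 (D1 x) <= wt o1 D].
  rewrite /D1; case: arg_minnP => [|D /andP[cD sD] h].
    by rewrite vcoverD1 ?vcoverT ?in_setD1 ?eqxx // => y _; rewrite inE.
  by split=> // D' c' s'; apply: h; rewrite c'.
have le01 x : x \in K -> wt o1 D0 <= wt o1 (D1 x).
  move=> xK; have [cx xD _] := D1P x; have := min0 (x |: D1 x).
  rewrite wtU1 // o1K //; apply; first exact: vcoverS (subsetUr _ _) cx.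
  exact: KD _ _ _ (or_introl erefl) cx xK xD.
pose m1 z := if z \in K then minn (m z) (wt o1 (D1 z) - wt o1 D0) else o1 z.
pose m2 z := m z - m1 z.
have le_m1 z : m1 z <= m z.
  by rewrite /m1 /o1; case: ifP => _; [apply: geq_minl|case: (_ \in _); rewrite ?mul1n].
pose s1 := wt o1 D0 + wt m1 K.
have claim1 : s1 <= tau G1 m1.
  have [D cD <-] := tauP G1 m1.
  have big D' : K \subset D' -> wt o1 D' + wt m1 K <= wt m1 D'.
    move=> /subsetP sK; rewrite -big_split; apply: leq_sum => z _ /=.
    have [zK|zK] := boolP (z \in K); first by rewrite sK // o1K // muln0.
    by rewrite /m1 (negPf zK) addn0.
  have [sK|/subsetPn[x xK xD]] := boolP (K \subset D).
    by apply: leq_trans (big _ sK); rewrite leq_add2r min0.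
  have := big (x |: D); rewrite !wtU1 // o1K // => /(_ (KD G1 D x (or_introl erefl) cD xK xD)).
  have [_ _ minx] := D1P x; have := minx D cD xD; have := le01 x xK.
  have : m1 x <= wt o1 (D1 x) - wt o1 D0 by rewrite /m1 xK geq_minr.
  by move=> h1 h2 h3 h4; rewrite /s1; lia.
have glue D' D : vcover G1 D' -> vcover G2 D ->
    vcover (gunion G1 G2) ((D' :&: vset G1) :|: (D :&: vset G2)).
  move=> /vcoverP c' /vcoverP c; apply/vcoverP => x y; rewrite !inE.
  case/orP => e; have /andP[-> ->] := edge_sub_vset e; rewrite !andbT.
    by case/orP: (c' _ _ e) => ->; rewrite ?orbT.
  by case/orP: (c _ _ e) => ->; rewrite ?orbT.
have zU z : (z \in K) = (z \in vset G1) && (z \in vset G2) by rewrite -vK inE.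
have caseK D : vcover G2 D -> K \subset D -> tau (gunion G1 G2) m <= s1 + wt m2 D.
  move=> cD /subsetP sK; apply: leq_trans (tau_le _ (glue _ _ cD0 cD)) _.
  rewrite /s1 -!big_split; apply: leq_sum => z _ /=; rewrite !inE.
  have [zK|zK] := boolP (z \in K).
    rewrite (sK z zK) mul1n mul1n /m2 -addnA subnKC //.
    by case: (_ || _); rewrite ?mul0n ?mul1n // leq_addl.
  move: (zK); rewrite zU /m2 /m1 (negPf zK) /o1 inE zK /=.
  by case: (z \in vset G1); case: (z \in vset G2); case: (z \in D0); case: (z \in D) => //=; lia.
(* x missing from D: either x keeps no weight in G2, and adding it to D is
   free, or the bound on m1 x is attained and D glues with D1 x *)
have claim2 : tau (gunion G1 G2) m <= s1 + tau G2 m2.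
  have [D cD <-] := tauP G2 m2.
  have [sK|/subsetPn[x xK xD]] := boolP (K \subset D); first exact: caseK.
  have [m1x|m1x] := leqP (m x) (wt o1 (D1 x) - wt o1 D0).
    have := caseK (x |: D); rewrite wtU1 // {1}/m2 {1}/m1 xK (minn_idPl m1x) subnn.
    by apply; [exact: vcoverS (subsetUr _ _) cD|exact: KD _ _ _ (or_intror erefl) cD xK xD].
  have [cx xDx _] := D1P x.
  have sK : K \subset x |: D by exact: KD _ _ _ (or_intror erefl) cD xK xD.
  suff: tau (gunion G1 G2) m + m1 x <= wt o1 (D1 x) + wt m1 K + wt m2 D.
    by have := le01 x xK; rewrite {1}/m1 xK (minn_idPr (ltnW m1x)) /s1; lia.
  apply: leq_trans (leq_add (tau_le m (glue _ _ cx cD)) (leqnn _)) _.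
  rewrite -[m1 x]addn0 -(_ : wt m1 set0 = 0); last by rewrite /wt big1 // => z _; rewrite inE.
  rewrite -wtU1 ?inE // -!big_split; apply: leq_sum => z _ /=; rewrite !inE orbF.
  have [->|zx] := eqVneq z x; first by rewrite (negPf xDx) (negPf xD) xK /= !mul0n !mul1n addn0; lia.
  rewrite mul0n addn0; have [zK|zK] := boolP (z \in K).
    have := subsetP sK z zK; rewrite !inE (negPf zx) /= => ->.
    rewrite mul1n mul1n /m2 -addnA subnKC //.
    by case: (_ || _); rewrite ?mul0n ?mul1n // leq_addl.
  move: (zK); rewrite zU /m2 /m1 (negPf zK) /o1 inE zK /=.
  by case: (z \in vset G1); case: (z \in vset G2); case: (z \in D1 x); case: (z \in D) => //=; lia.
apply: packable_leq claim2 _.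
apply: packable_leq (leq_add claim1 (leqnn _)) _.
have := packableD (packable_induced i1 (k1 m1)) (packable_induced i2 (k2 m2)).
by move=> h; apply: packable_mono h _ => z; rewrite subnKC.
Qed.

End Covers.

Lemma konig_clique_sums (V : finType) (G : sgraph V) :
  clique_sums_of (@bipartite_or_odd_cycle V) G -> konig G.
Proof.
elim=> {G} [G [_ [bip|[n cG]]]|G1 G2 G _ k1 _ k2 sG].
- exact: konig_bipartite.
- by apply: (@konig_odd_cycle _ n) (cG); case: cG; case: n.
- exact: konig_clique_sum sG k1 k2.
Qed.

Import GRing.Theory.
Local Open Scope ring_scope.

(** * Arithmetic of ideals *)

Section IdealTheory.
Variable R : comNzRingType.
Implicit Types I J S : R -> Prop.

Lemma ideal_sum_closed I (T : Type) (r : seq T) (F : T -> R) :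
  is_ideal I -> (forall i, I (F i)) -> I (\sum_(i <- r) F i).
Proof. by move=> [I0 ID _] IF; elim/big_ind: _. Qed.

Lemma ideal_gen_min S I : is_ideal I -> (forall x, S x -> I x) ->
  forall x, ideal_gen S x -> I x.
Proof.
move=> idI SI x [k [a [b [Sb ->]]]]; apply: ideal_sum_closed => // i.
by have [_ _ IM] := idI; apply/IM/SI.
Qed.

Lemma ideal_gen_sub S x : S x -> ideal_gen S x.
Proof.
by move=> Sx; exists 1%N, (fun=> 1), (fun=> x); rewrite big_ord1 mul1r.
Qed.

Lemma ideal_gen_ideal S : is_ideal (ideal_gen S).
Proof.
split.
- by exists 0%N, (fun=> 0), (fun=> 0); rewrite big_ord0; split=> // -[].
- move=> x y [k [a [b [Sb ->]]]] [l [c [d [Sd ->]]]].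
  pose glue (u : 'I_k -> R) (v : 'I_l -> R) i :=
    match split i with inl j => u j | inr j => v j end.
  exists (k + l)%N, (glue a c), (glue b d); split.
    by move=> i; rewrite /glue; case: (split i).
  rewrite big_split_ord; congr (_ + _); apply: eq_bigr => i _.
    by rewrite /glue -[lshift l i]/(unsplit (inl i)) unsplitK.
  by rewrite /glue -[rshift k i]/(unsplit (inr i)) unsplitK.
- move=> c x [k [a [b [Sb ->]]]]; exists k, (fun i => c * a i), b; split=> //.
  by rewrite mulr_sumr; apply: eq_bigr => i _; rewrite mulrA.
Qed.

Lemma ideal_mulP I J x y : I x -> J y -> ideal_mul I J (x * y).
Proof. by move=> Ix Jy; apply: ideal_gen_sub; exists x, y. Qed.

Lemma ideal_mul_min I J L : is_ideal L -> (forall x y, I x -> J y -> L (x * y)) ->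
  forall z, ideal_mul I J z -> L z.
Proof. by move=> idL h; apply: ideal_gen_min => // z [x [y [Ix Jy ->]]]; apply: h. Qed.

Lemma ideal_mul_ideal I J : is_ideal (ideal_mul I J).
Proof. exact: ideal_gen_ideal. Qed.

Lemma ideal_exp_ideal I s : is_ideal (ideal_exp I s).
Proof. by case: s => [|s]; [split|apply: ideal_mul_ideal]. Qed.

(** This turns a statement about multiples by a fixed [c] into an instance of
[ideal_gen_min] or [ideal_mul_min]. *)
Lemma ideal_colon I c : is_ideal I -> is_ideal (fun x => I (x * c)).
Proof.
move=> [I0 ID IM]; split=> [|x y Ix Iy|a x Ix].
- by rewrite mul0r.
- by rewrite mulrDl; apply: ID.
- by rewrite -mulrA; apply: IM.
Qed.

Lemma ideal_expD I k l x y :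
  ideal_exp I k x -> ideal_exp I l y -> ideal_exp I (k + l) (x * y).
Proof.
move=> Ix Iy; elim: k x Ix => [|k IH] x /=.
  by move=> _; have [_ _ IM] := ideal_exp_ideal I l; apply: IM.
apply: (ideal_mul_min (ideal_colon y (ideal_mul_ideal I (ideal_exp I (k + l))))).
by move=> u v Iu Iv; rewrite -mulrA; apply: ideal_mulP => //; apply: IH.
Qed.

(** Powers of an ideal are the smallest filtration compatible with it. *)
Lemma ideal_exp_filtration I (F : nat -> R -> Prop) :
    (forall k, is_ideal (F k)) -> (forall x, F 0 x) ->
    (forall k x y, I x -> F k y -> F k.+1 (x * y)) ->
  forall s x, ideal_exp I s x -> F s x.
Proof.
move=> idF F0 FS; elim=> [//|s IH] x /=; apply: ideal_mul_min => // u v Iu Iv.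
by apply: FS => //; apply: IH.
Qed.

(** Multiplication by [u] moves the [i]-th factor from [F i] to [F' i].  The
product of ideals is not associative up to conversion, so the factor is reached
by recursion on the list. *)
Lemma big_ideal_mul_bump (T : eqType) (l : seq T) (F F' : T -> R -> Prop) (i : T) u h :
    uniq l -> i \in l -> (forall j x, j != i -> F j x -> F' j x) ->
    (forall x, F i x -> F' i (u * x)) ->
  (\big[@ideal_mul R/@ideal_one R]_(j <- l) F j) h ->
  (\big[@ideal_mul R/@ideal_one R]_(j <- l) F' j) (u * h).
Proof.
move=> ul il FF' Fu; have sub s : i \notin s -> forall x,
    (\big[@ideal_mul R/@ideal_one R]_(j <- s) F j) x ->
    (\big[@ideal_mul R/@ideal_one R]_(j <- s) F' j) x.
  elim: s => [_ x|j s IH]; first by rewrite !big_nil.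
  rewrite inE negb_or => /andP[ij is'] x; rewrite !big_cons.
  apply: ideal_mul_min => [|y z Fy Fz]; first exact: ideal_mul_ideal.
  by apply: ideal_mulP; [apply: FF'; rewrite // eq_sym|apply: IH].
elim: l ul il h => [//|j l IH] /= /andP[jl ul]; rewrite inE => il h.
rewrite !big_cons [u * h]mulrC.
apply: (ideal_mul_min (ideal_colon u (ideal_mul_ideal _ _))) h.
move=> y z Fy Fz; rewrite mulrC.
have [ij|ij] := eqVneq i j.
  by subst j; rewrite mulrA; apply: ideal_mulP; [apply: Fu|apply: sub Fz].
rewrite mulrCA; apply: ideal_mulP; first by apply: FF'; rewrite // eq_sym.
by move: il; rewrite (negPf ij) /= => il; apply: IH.
Qed.

End IdealTheory.

(** * Localization at a prime *)

Section Saturation.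
Variable R : comNzRingType.
Implicit Types I J P : R -> Prop.

Lemma ideal_mul_scalel I I' J u h : (forall x, I x -> I' (u * x)) ->
  ideal_mul I J h -> ideal_mul I' J (u * h).
Proof.
move=> Iu; rewrite mulrC.
apply: (ideal_mul_min (ideal_colon u (ideal_mul_ideal I' J))) => x y Ix Jy.
by rewrite mulrC mulrA; apply: ideal_mulP => //; apply: Iu.
Qed.

Lemma ideal_mul_scaler I J J' u h : (forall x, J x -> J' (u * x)) ->
  ideal_mul I J h -> ideal_mul I J' (u * h).
Proof.
move=> Ju; rewrite mulrC.
apply: (ideal_mul_min (ideal_colon u (ideal_mul_ideal I J'))) => x y Ix Jy.
by rewrite -mulrA [y * u]mulrC; apply: ideal_mulP => //; apply: Ju.
Qed.

Lemma ideal_exp1 I x : I x -> ideal_exp I 1 x.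
Proof. by move=> Ix; rewrite -[x]mulr1; apply: ideal_mulP. Qed.

Lemma ideal_exp_prod I n (E : nat -> R) : (forall k, I (E k)) ->
  ideal_exp I n (\prod_(k < n) E k).
Proof.
move=> IE; elim: n => [//|n IH].
by rewrite big_ord_recr /= mulrC; apply: ideal_mulP.
Qed.

(** The contraction to [R] of the extension of [J] to the localization at [P]. *)
Definition saturation P J : R -> Prop := fun h => exists g, ~ P g /\ J (g * h).

Lemma saturation_ideal P J :
  is_prime_ideal P -> is_ideal J -> is_ideal (saturation P J).
Proof.
move=> [_ P1 Ppr] [J0 JD JM]; split.
- by exists 1; rewrite mulr0.
- move=> x y [g [Pg Jx]] [h [Ph Jy]]; exists (g * h); split; first by case/Ppr.
  by rewrite mulrDr; apply: JD; [rewrite mulrAC [_ * h]mulrC|rewrite -mulrA]; apply: JM.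
- by move=> a x [g [Pg Jx]]; exists g; rewrite mulrCA; split=> //; apply: JM.
Qed.

Lemma saturation_expD P I k l x y : is_prime_ideal P ->
  saturation P (ideal_exp I k) x -> saturation P (ideal_exp I l) y ->
  saturation P (ideal_exp I (k + l)) (x * y).
Proof.
move=> [_ _ Ppr] [g [Pg Ix]] [h [Ph Iy]]; exists (g * h); split; first by case/Ppr.
by rewrite mulrACA; apply: ideal_expD.
Qed.

Lemma saturation_sub P J x : is_prime_ideal P -> J x -> saturation P J x.
Proof. by move=> [_ P1 _] Jx; exists 1; rewrite mul1r. Qed.

End Saturation.

Section Localization.
Variable R : idomainType.
Implicit Types P J : R -> Prop.

Lemma extended_tofracP P J f : is_prime_ideal P -> is_ideal J ->
  extended P J (tofrac f) <-> saturation P J f.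
Proof.
move=> [[P0 _ _] P1 Ppr] [J0 JD JM]; split; last first.
  move=> [g [Pg Jgf]]; exists 1%N, (fun=> tofrac 1 / tofrac g), (fun=> g * f).
  split=> // [_|]; first by exists 1, g.
  have g0 : tofrac g != 0.
    rewrite tofrac_eq0; apply: contra_not_neq Pg => ->; exact: P0.
  by rewrite big_ord1 tofracM tofrac1 mul1r mulKf.
move=> [k [c [b [Pc Jb E]]]].
suff [g [Pg [h [Jh]]]] : exists g, ~ P g /\
    exists h, J h /\ (\sum_(i < k) c i * tofrac (b i)) * tofrac g = tofrac h.
  rewrite -E -tofracM => /eqP; rewrite tofrac_eq => /eqP fg.
  by exists g; split=> //; rewrite mulrC fg.
elim/big_rec: _ => [|i x _ [g [Pg [h [Jh gh]]]]].
  by exists 1; split=> //; exists 0; rewrite mul0r tofrac0.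
have [a [d [Pd cE]]] := Pc i.
exists (d * g); split; first by case/Ppr.
exists (a * g * b i + d * h); split; first by apply: JD; apply: JM.
have d0 : tofrac d != 0.
  rewrite tofrac_eq0; apply: contra_not_neq Pd => ->; exact: P0.
rewrite mulrDl cE tofracD !tofracM -gh; congr (_ + _); last by rewrite mulrCA.
by rewrite -!mulrA; congr (_ * _); rewrite mulrCA mulKf // mulrC.
Qed.

End Localization.

Lemma coef_mul_vanish (S : nzRingType) (p q : {poly S}) a b :
    (forall k, (k < a)%N -> p`_k = 0) -> (forall k, (k < b)%N -> q`_k = 0) ->
  forall k, (k < a + b)%N -> (p * q)`_k = 0.
Proof.
move=> hp hq k kab; rewrite coefM big1 // => i _.
have [ia|ai] := ltnP i a; first by rewrite hp // mul0r.
by rewrite hq ?mulr0 //; move: kab ai (ltn_ord i); clear; lia.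
Qed.

(** The lowest nonzero coefficient of [q] of index [k] would survive in the
product as [p`_0 * q`_k]. *)
Lemma coef_mul_cancel (S : idomainType) (p q : {poly S}) s : p`_0 != 0 ->
    (forall k, (k < s)%N -> (p * q)`_k = 0) ->
  forall k, (k < s)%N -> q`_k = 0.
Proof.
move=> p0 hpq; elim/ltn_ind => k IH ks; have := hpq k ks.
rewrite coefM big_ord_recl subn0 big1 ?addr0 => [/eqP|i _].
  by rewrite mulf_eq0 (negPf p0) => /eqP.
rewrite (IH (k - lift ord0 i)%N) ?mulr0 //; rewrite lift0; move: ks (ltn_ord i); clear; lia.
Qed.

(** * Monomials and the edge ideal *)

Section Monomials.
Variables (K : fieldType) (V : finType).
Implicit Types (G : sgraph V) (C : {set V}) (w : V -> nat) (m : 'X_{1..#|V|}).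
Local Notation R := {mpoly K[#|V|]}.
Implicit Types (f g p : R).

(** Exponent vectors are handled as weights on the vertices. *)
Definition expo m : V -> nat := fun x => m (enum_rank x).

Definition xpow w : R := \prod_x vvar K x ^+ w x.

Lemma eq_xpow w w' : w =1 w' -> xpow w = xpow w'.
Proof. by move=> e; apply: eq_bigr => x _; rewrite e. Qed.

Lemma xpowD w w' : xpow (fun x => w x + w' x)%N = xpow w * xpow w'.
Proof. by rewrite -big_split; apply: eq_bigr => x _; rewrite exprD. Qed.

Lemma xpow_pred1 y : xpow (fun x => x == y) = vvar K y.
Proof.
rewrite /xpow (bigD1 y) //= eqxx expr1 big1 ?mulr1 // => x /negPf ->.
by rewrite expr0.
Qed.

Lemma xpow_set C : xpow (fun x => x \in C) = \prod_(x in C) vvar K x.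
Proof.
by rewrite [RHS]big_mkcond; apply: eq_bigr => x _; case: (x \in C).
Qed.

Lemma xpow_expo m : xpow (expo m) = 'X_[m].
Proof.
rewrite mpolyXE_id /xpow (reindex (@enum_val V predT)) /=.
  by apply: eq_bigr => i _; rewrite /vvar /expo enum_valK.
exact/onW_bij/enum_val_bij.
Qed.

Lemma ideal_xpow_leq I w w' : is_ideal I -> (forall x, w x <= w' x)%N ->
  I (xpow w) -> I (xpow w').
Proof.
move=> [_ _ IM] le Iw; rewrite -(eq_xpow (fun x => subnK (le x))) xpowD.
exact: IM.
Qed.

Lemma ideal_monomials I p : is_ideal I ->
  (forall m, m \in msupp p -> I 'X_[m]) -> I p.
Proof.
move=> [I0 ID IM] h; rewrite [p]mpolyE big_seq_cond.
by elim/big_ind: _ => // m /andP[/h mp _]; rewrite -mul_mpolyC; apply: IM.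
Qed.

Lemma monomial_ideal_ideal (T : pred 'X_{1..#|V|}) :
  (forall m m', T m' -> T (m + m')%MM) ->
  is_ideal (fun p => forall m, m \in msupp p -> T m).
Proof.
move=> up; split=> [m|p q hp hq m /msuppD_le|p q hq m /msuppM_le/allpairsP].
- by rewrite msupp0.
- by rewrite mem_cat => /orP[/hp|/hq].
- by move=> [[m1 m2] /= [_ /hq h ->]]; apply: up.
Qed.

Definition has_edge G m : bool :=
  [exists x, exists y, [&& [set x; y] \in edges G, 0 < expo m x & 0 < expo m y]]%N.

Lemma has_edgeP G m : reflect
  (exists x y, [/\ [set x; y] \in edges G, 0 < expo m x & 0 < expo m y]%N) (has_edge G m).
Proof.
apply: (iffP existsP) => [[x /existsP[y /and3P[e hx hy]]]|[x [y [e hx hy]]]].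
  by exists x, y.
by exists x; apply/existsP; exists y; rewrite e hx.
Qed.

Lemma edge_ideal_gen G x y : [set x; y] \in edges G ->
  edge_ideal K G (vvar K x * vvar K y).
Proof. by move=> e; apply: ideal_gen_sub; exists x, y. Qed.

Lemma edge_ideal_ideal G : is_ideal (edge_ideal K G).
Proof. exact: ideal_gen_ideal. Qed.

Lemma expoD m m' x : expo (m + m')%MM x = (expo m x + expo m' x)%N.
Proof. by rewrite /expo mnmDE. Qed.

Lemma expoU y x : expo U_(enum_rank y)%MM x = (x == y) :> nat.
Proof. by rewrite /expo mnm1E (inj_eq enum_rank_inj) eq_sym. Qed.

(** Membership in a monomial ideal is decided monomial by monomial. *)
Lemma edge_idealP G p :
  edge_ideal K G p <-> forall m, m \in msupp p -> has_edge G m.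
Proof.
split.
  have up m m' : has_edge G m' -> has_edge G (m + m')%MM.
    move=> /has_edgeP[x [y [e hx hy]]].
    by apply/has_edgeP; exists x, y; rewrite !expoD !addn_gt0 hx hy !orbT.
  apply: (ideal_gen_min (monomial_ideal_ideal up)).
  move=> _ [x [y [e ->]]] m; rewrite /vvar -mpolyXD msuppX inE => /eqP ->.
  apply/has_edgeP; exists x, y; split=> //.
    by rewrite expoD !expoU eqxx.
  by rewrite expoD !expoU eqxx addn1.
move=> h; apply: ideal_monomials (edge_ideal_ideal G) _ => m.
move=> /h/has_edgeP[x [y [e hx hy]]]; have nxy := edge_neq e.
rewrite -xpow_expo.
apply: (@ideal_xpow_leq _ (fun z => (z == x) + (z == y))%N) (edge_ideal_ideal G) _ _.
  move=> z; case: eqP => [->|_]; first by rewrite (negPf nxy) addn0.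
  by case: eqP => [->|].
by rewrite xpowD !xpow_pred1; apply: edge_ideal_gen.
Qed.

(** * Order of vanishing along a vertex cover *)

(** Each variable in [C] gets multiplied by a new variable, whose exponent then
records the weight of a monomial on [C]; products are thereby controlled by
univariate polynomials over a domain. *)
Definition grade C : R -> {poly R} :=
  mmap (polyC \o @mpolyC _ K) (fun i => 'X^(enum_val i \in C) * ('X_i)%:P).

Fact grade_is_zmod_morphism C : zmod_morphism (grade C).
Proof. exact: mmap_is_additive. Qed.

Fact grade_is_monoid_morphism C : monoid_morphism (grade C).
Proof. by split; [exact: rmorph1|move=> f g; exact: rmorphM]. Qed.

HB.instance Definition _ C :=
  GRing.isZmodMorphism.Build R {poly R} (grade C) (grade_is_zmod_morphism C).
HB.instance Definition _ C :=
  GRing.isMonoidMorphism.Build R {poly R} (grade C) (grade_is_monoid_morphism C).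

Lemma gradeM C f g : grade C (f * g) = grade C f * grade C g.
Proof. exact: rmorphM. Qed.

Lemma grade_vvar C x : grade C (vvar K x) = 'X^(x \in C) * (vvar K x)%:P.
Proof. by rewrite /grade mmapX mmap1U enum_rankK. Qed.

Lemma grade_xpow C w : grade C (xpow w) = 'X^(wt w C) * (xpow w)%:P.
Proof.
rewrite /xpow /wt !rmorph_prod -prodrXr -big_split.
apply: eq_bigr => x _ /=.
by rewrite rmorphXn /= grade_vvar exprMn -exprM rmorphXn.
Qed.

Lemma coef_grade C p k m :
  ((grade C p)`_k)@_m = if k == wt (expo m) C then p@_m else 0.
Proof.
rewrite {1}[p]mpolyE raddf_sum coef_sum raddf_sum /=.
have E m' : ((grade C (p@_m' *: 'X_[m']))`_k)@_m =
    if m' == m then if k == wt (expo m) C then p@_m else 0 else 0.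
  rewrite /grade mmapZ -/(grade C _) -xpow_expo grade_xpow mulrCA coefXnM.
  case: ltnP => [lt|le].
    rewrite mcoeff0; case: eqP => // E; subst m'.
    by rewrite ltn_eqF.
  rewrite /= -polyCM coefC subn_eq0 xpow_expo.
  have -> : (k <= wt (expo m') C)%N = (k == wt (expo m') C) by rewrite eqn_leq le andbT.
  case: (k =P wt (expo m') C) => E; last first.
    by rewrite mcoeff0; case: eqP => // E'; subst m'; case: eqP.
  rewrite mcoeffCM mcoeffX; case: eqP => [E'|_]; last by rewrite mulr0.
  by subst m'; rewrite E eqxx mulr1.
rewrite (eq_bigr _ (fun m' _ => E m')).
have [mp|mp] := boolP (m \in msupp p).
  rewrite (bigD1_seq m mp (msupp_uniq p)) /= eqxx big1 ?addr0 //.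
  by move=> m' /negPf ->.
rewrite big1_seq => [|m' /= m'p].
  by move: mp; rewrite -mcoeff_eq0 => /eqP ->; rewrite if_same.
by case: eqP m'p mp => // -> ->.
Qed.

(** Membership in the [s]-th power of the ideal spanned by the variables in [C]. *)
Definition order_ge C s f : bool := all (fun m => s <= wt (expo m) C)%N (msupp f).

Lemma order_ge_grade C s f :
  order_ge C s f <-> forall k, (k < s)%N -> (grade C f)`_k = 0.
Proof.
split=> [/allP h k ks|h].
  apply/mpolyP => m; rewrite coef_grade mcoeff0; case: eqP => // E.
  by apply/eqP; rewrite mcoeff_eq0; apply/negP => /h; rewrite -E leqNgt ks.
apply/allP => m mf; rewrite leqNgt; apply/negP => /h/(congr1 (mcoeff m)).
by rewrite coef_grade eqxx mcoeff0 => /eqP; rewrite mcoeff_eq0 mf.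
Qed.

Lemma order_ge_mul C a b f g :
  order_ge C a f -> order_ge C b g -> order_ge C (a + b) (f * g).
Proof.
move=> /order_ge_grade hf /order_ge_grade hg; apply/order_ge_grade => k; rewrite gradeM.
exact: coef_mul_vanish.
Qed.

Lemma order_ge_cancel C s f g :
  ~~ order_ge C 1 g -> order_ge C s (g * f) -> order_ge C s f.
Proof.
move=> g1 /order_ge_grade hgf; have g0 : (grade C g)`_0 != 0.
  by apply: contra g1 => /eqP g0; apply/order_ge_grade => -[].
by apply/order_ge_grade; apply: coef_mul_cancel g0 _ => k /hgf; rewrite gradeM.
Qed.

Lemma order_ge_ideal C s : is_ideal (order_ge C s).
Proof.
have up m m' : (s <= wt (expo m') C -> s <= wt (expo (m + m')%MM) C)%N.
  by rewrite (eq_wt _ (expoD m m')) wtD => h; apply: leq_trans h (leq_addl _ _).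
have [I0 ID IM] := monomial_ideal_ideal (T := fun m => (s <= wt (expo m) C)%N) up.
split=> [|f g /allP hf /allP hg|f g /allP hg]; apply/allP.
- exact: I0.
- exact: ID.
- exact: IM.
Qed.

Lemma order_ge1_prime C : is_prime_ideal (order_ge C 1).
Proof.
split; first exact: order_ge_ideal.
  rewrite /order_ge msupp1 /= andbT /wt big1 // => x _.
  by rewrite /expo mnm0E muln0.
move=> f g h; have [f1|f1] := boolP (order_ge C 1 f); [by left|right].
exact: order_ge_cancel f1 h.
Qed.

Lemma edge_ideal_order_ge G C : vcover G C ->
  forall f, edge_ideal K G f -> order_ge C 1 f.
Proof.
move=> cC f If; apply/allP => m.
move/edge_idealP: If => h /h/has_edgeP[x [y [e hx hy]]].
have ex z : z \in C -> (0 < expo m z)%N -> (0 < wt (expo m) C)%N.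
  by move=> zC hz; rewrite (wtD1 _ zC) addn_gt0 hz.
by case/orP: (vcoverP _ _ cC _ _ e) => h'; apply: ex h' _.
Qed.

(** The prime is the annihilator of the product of the variables outside [C]:
multiplied by it, a variable in [C] completes an edge with a neighbour outside
[C]. *)
Lemma minimal_vcover_associated G C : vcover G C ->
  (forall x, x \in C -> exists2 y, [set x; y] \in edges G & y \notin C) ->
  associated_prime (edge_ideal K G) (order_ge C 1).
Proof.
move=> cC priv; split; first exact: order_ge1_prime.
pose u := xpow (fun x => x \in ~: C).
exists u => g; split=> [/allP hg|/(edge_ideal_order_ge cC)].
  apply: (ideal_monomials (ideal_colon _ (edge_ideal_ideal G))) => m /hg.
  rewrite lt0n sum_nat_eq0 => /forallPn[x].
  rewrite /= muln_eq0 negb_or eqb0 negbK -lt0n => /andP[xC mx].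
  have [y e yC] := priv x xC.
  rewrite -xpow_expo -xpowD.
  apply: (@ideal_xpow_leq _ (fun z => (z == x) + (z == y))%N) (edge_ideal_ideal G) _ _.
    move=> z; rewrite !inE; have [->|_] := eqVneq z y.
      by rewrite yC; case: eqP yC => [->|_ _]; rewrite ?xC // leq_addl.
    by rewrite addn0; case: eqP => [->|//]; apply: leq_trans mx (leq_addr _ _).
  by rewrite xpowD !xpow_pred1; apply: edge_ideal_gen.
have [_ _ pr] := order_ge1_prime C; case/pr => // /order_ge_grade/(_ 0%N isT).
rewrite grade_xpow (_ : wt _ _ = 0%N) ?expr0 ?mul1r ?coefC ?eqxx.
  move/eqP; rewrite (negPf (_ : xpow _ != 0)) //.
  apply/prodf_neq0 => x _; apply: expf_neq0; apply/eqP => /(congr1 (mcoeff U_(enum_rank x))).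
  by rewrite mcoeffX eqxx mcoeff0 => /eqP; rewrite oner_eq0.
by rewrite /wt big1 // => x _; rewrite inE; case: (x \in C).
Qed.

(** Every cover contains an inclusion-minimal one, which spans an associated prime;
a denominator outside of that prime has order 0 along the cover and can be
cancelled. *)
Lemma symbolic_power_monomials G s f : symbolic_power (edge_ideal K G) s f ->
  forall m, m \in msupp f -> (s <= tau G (expo m))%N.
Proof.
move=> sf m mf; have [D cD <-] := tauP G (expo m).
have [C /minsetP[cC minC] CD] := minset_exists (P := vcover G) cD.
suff h : order_ge C s f.
  apply: leq_trans (allP h _ mf) _; apply: leq_wt => x; rewrite leq_mul2r.
  by apply/orP; right; case: (boolP (x \in C)) => // /(subsetP CD) ->.
have priv x : x \in C -> exists2 y, [set x; y] \in edges G & y \notin C.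
  move=> xC.
  have [/existsP[y /andP[e yC]]|none] :=
    boolP [exists y, ([set x; y] \in edges G) && (y \notin C)]; first by exists y.
  have cCx : vcover G (C :\ x).
    apply: vcoverD1 cC _ => y exy.
    by move: none; rewrite negb_exists => /forallP/(_ y); rewrite exy negbK.
  have := minC _ cCx (subD1set _ _) => /setP/(_ x).
  by rewrite !inE eqxx xC.
have /extended_tofracP := sf _ (minimal_vcover_associated cC priv).
case/(_ (order_ge1_prime C) (ideal_exp_ideal _ _)) => g [/negP g1 Igf].
apply: order_ge_cancel g1 _; move: Igf.
apply: (@ideal_exp_filtration _ (edge_ideal K G) (fun s => order_ge C s)).
- exact: order_ge_ideal.
- by move=> x; apply/allP.
- by move=> k x y /(edge_ideal_order_ge cC) hx hy; rewrite -add1n; apply: order_ge_mul.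
Qed.

End Monomials.

(** * Powers and odd cycles at an associated prime *)

Lemma is_cycle_card (V : finType) N (C : sgraph V) : is_cycle N C -> #|vset C| = N.
Proof. by move=> [_ [f [finj -> _]]]; rewrite card_imset // card_ord. Qed.

Lemma prod_cycle (V : finType) (R : comNzRingType) n (C : sgraph V) g (F : V -> R) :
    cyclic_walk n.*2.+1 C g ->
  \prod_(x in vset C) F x =
    F (g 0%N) * \prod_(k < n) (F (g k.*2.+1) * F (g k.*2.+2)).
Proof.
move=> wg; have [_ -> _ _] := wg.
rewrite big_imset => [|i j _ _ /eqP]; last first.
  by rewrite (cyclic_walk_inj wg) // => /eqP/val_inj.
rewrite (eq_bigl xpredT) => [|i]; last by rewrite inE.
rewrite big_ord_recl; congr (_ * _).
have -> : \prod_(i < n.*2) F (g (lift ord0 i)) = \prod_(i < n.*2) F (g i.+1).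
  by apply: eq_bigr => i _; rewrite lift0.
elim: n {wg} => [|n IH]; first by rewrite !big_ord0.
by rewrite doubleS !big_ord_recr /= IH mulrA.
Qed.

Section GraphIdealTheory.
Variables (K : fieldType) (V : finType).
Implicit Types (G : sgraph V) (w : V -> nat) (m : 'X_{1..#|V|}).
Local Notation R := {mpoly K[#|V|]}.
Implicit Types (f g p : R) (P : R -> Prop).

Lemma msupp_mul_vvar f m x : m \in msupp f ->
  (m + U_(enum_rank x))%MM \in msupp (vvar K x * f).
Proof.
by rewrite !mcoeff_msupp mulrC addmC mcoeffMX.
Qed.

Lemma associated_prime_sub G P : associated_prime (edge_ideal K G) P ->
  forall g, edge_ideal K G g -> P g.
Proof.
move=> [_ [f Pf]] g Ig; apply/Pf; have [_ _ IM] := edge_ideal_ideal K G.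
by rewrite mulrC; apply: IM.
Qed.

(** Let [P = (I : f)] and let [m] be a monomial of [f] outside [I].  As [x m] lies
in [I], some neighbour [y] of [x] divides [m].  If [y] were in [P], then [y m]
would contain an edge, which [m] contains already. *)
Lemma associated_prime_neighbor G P x :
  associated_prime (edge_ideal K G) P -> P (vvar K x) ->
  exists y, [set x; y] \in edges G /\ ~ P (vvar K y).
Proof.
move=> [[_ P1 _] [f Pf]] Px.
have [m mf mG] : exists2 m, m \in msupp f & ~~ has_edge G m.
  apply/hasP; rewrite has_predC; apply/negP => /allP h; apply: P1; apply/Pf.
  by rewrite mul1r; apply/edge_idealP.
have supp z : P (vvar K z) -> has_edge G (m + U_(enum_rank z))%MM.
  by move/Pf/edge_idealP; apply; apply: msupp_mul_vvar.
suff [y e my] : exists2 y, [set x; y] \in edges G & (0 < expo m y)%N.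
  exists y; split=> // /supp/has_edgeP[a [b [eab]]].
  have pos z : (0 < expo (m + U_(enum_rank y)) z)%N -> (0 < expo m z)%N.
    by rewrite expoD expoU; case: eqP => [->|_]; rewrite ?addn0.
  move=> /pos ma /pos mb; case/negP: mG; apply/has_edgeP; by exists a, b.
have /has_edgeP[a [b [e]]] := supp x Px.
rewrite !expoD !expoU; have nab := edge_neq e.
have [ax|ax] := eqVneq a x.
  by subst a; rewrite [b == x]eq_sym (negPf nab) addn0 => _ mb; exists b.
rewrite addn0 => ma; have [bx|bx] := eqVneq b x.
  by subst b => _; exists a; rewrite // setUC.
rewrite addn0 => mb; case/negP: mG; apply/has_edgeP; by exists a, b.
Qed.

(** An edge of the cycle has an end in [P], from which the walk is started: this
vertex belongs to [I] locally at [P], and the 2n others form n edges. *)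
Lemma odd_cycle_saturation G P n : associated_prime (edge_ideal K G) P ->
  forall f, odd_cycle_ideal K n G f ->
  saturation P (ideal_exp (edge_ideal K G) n.+1) f.
Proof.
move=> aP; have [Ppr _] := aP.
apply: ideal_gen_min.
  by apply: saturation_ideal Ppr _; apply: ideal_exp_ideal.
move=> _ [C [[[sC eC] cC] ->]].
have [g0 wg0] := cyclic_walk_exists cC.
have eG h i : cyclic_walk n.*2.+1 C h -> [set h i; h i.+1] \in edges G.
  by move=> [_ _ /(_ i) + _]; rewrite eC inE => /andP[].
have [h wh Ph] : exists2 h, cyclic_walk n.*2.+1 C h & P (vvar K (h 0%N)).
  have [_ _ pr] := Ppr.
  have := associated_prime_sub aP (edge_ideal_gen K (eG _ 0%N wg0)).
  case/pr => hP; first by exists g0.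
  by exists (fun i => g0 (i + 1)%N); first exact: cyclic_walk_shift.
rewrite (prod_cycle _ wh) -add1n; apply: saturation_expD => //.
  have [y [e Py]] := associated_prime_neighbor aP Ph.
  exists (vvar K y); split=> //; rewrite mulrC.
  by apply: ideal_exp1; apply: edge_ideal_gen.
apply: saturation_sub Ppr _.
apply: (ideal_exp_prod n (E := fun k => vvar K (h k.*2.+1) * vvar K (h k.*2.+2))) => k.
by apply: edge_ideal_gen; apply: eG wh.
Qed.

Section Decomposition.
Variables (G : sgraph V) (r : nat) (n : 'I_r -> nat).

Local Notation cyc a := (\big[@ideal_mul R/@ideal_one R]_(i < r)
          ideal_exp (odd_cycle_ideal K (n i) G) (a i)).

Lemma mixed_product_symbolic t (a : 'I_r -> nat) f :
  ideal_mul (ideal_exp (edge_ideal K G) t) (cyc a) f ->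
  symbolic_power (edge_ideal K G) (t + \sum_(i < r) (n i).+1 * a i)%N f.
Proof.
move=> If P aP; have [Ppr _] := aP.
apply/(extended_tofracP _ Ppr (ideal_exp_ideal _ _)).
have idS k : is_ideal (saturation P (ideal_exp (edge_ideal K G) k)).
  by apply: saturation_ideal Ppr _; apply: ideal_exp_ideal.
apply: ideal_mul_min If => // x y Ix cy; apply: saturation_expD => //.
  exact: saturation_sub.
move: y cy; elim/big_rec2: _ => [y _|i J k _ IH].
  exact: saturation_sub.
move=> y; apply: ideal_mul_min => // u v Ju Jv.
apply: saturation_expD => //; last exact: IH.
move: Ju; apply: (@ideal_exp_filtration _ _
  (fun k => saturation P (ideal_exp (edge_ideal K G) ((n i).+1 * k)))) => //.
  by move=> z; apply: saturation_sub; rewrite // muln0.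
move=> k' c d /(odd_cycle_saturation aP) Jc Jd.
by rewrite mulnS; apply: saturation_expD.
Qed.

Hypothesis n_all : forall (m : nat) (C : sgraph V), odd m -> induced_cycle m G C ->
    exists i, is_cycle (n i).*2.+1 C.

(** Each induced odd cycle of the packing raises the exponent [a i] of its length. *)
Lemma packable_mixed_product w s : packable G w s ->
  exists t a, s = (t + \sum_(i < r) (n i).+1 * a i)%N /\
    ideal_mul (ideal_exp (edge_ideal K G) t) (cyc a) (xpow K w).
Proof.
elim=> {w s} [w|w w' s x y e _ [t [a [-> Iw']]] le|w w' s k C iC _ [t [a [-> Iw']]] le].
- exists 0%N, (fun=> 0%N); split; first by rewrite big1 // => i _; rewrite muln0.
  rewrite -[xpow K w]mulr1; apply: ideal_mulP => //.
  elim/big_rec: _ => // i J _ J1.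
  by rewrite -[1]mulr1; apply: ideal_mulP.
- exists t.+1, a; split=> //; apply: ideal_xpow_leq (ideal_mul_ideal _ _) le _.
  rewrite xpowD [_ * xpow _ _]mulrC xpowD !xpow_pred1.
  by apply: ideal_mul_scalel Iw' => z; apply: ideal_mulP; apply: edge_ideal_gen.
have [i ci] : exists i, is_cycle (n i).*2.+1 C.
  by apply: (n_all _ iC); rewrite /= odd_double.
have kE : k = n i.
  have [_ ck] := iC; have := is_cycle_card ck; rewrite (is_cycle_card ci).
  by case=> /double_inj.
subst k; exists t, (fun j => a j + (j == i))%N; split.
  rewrite -addnA; congr (_ + _)%N.
  transitivity (\sum_(j < r) (n j).+1 * a j + \sum_(j < r) (n j).+1 * (j == i))%N.
    congr (_ + _)%N; rewrite (bigD1 i) //= eqxx muln1 big1 ?addn0 //.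
    by move=> j /negPf ->; rewrite muln0.
  by rewrite -big_split; apply: eq_bigr => j _; rewrite mulnDr.
apply: ideal_xpow_leq (ideal_mul_ideal _ _) le _.
rewrite xpowD [_ * xpow _ _]mulrC xpow_set.
apply: ideal_mul_scaler Iw' => z.
apply: (big_ideal_mul_bump (i := i)) => [|||{}z].
- exact: index_enum_uniq.
- exact: mem_index_enum.
- by move=> j z' /negPf ->; rewrite addn0.
- rewrite eqxx addn1; apply: ideal_mulP; apply: ideal_gen_sub.
  by exists C.
Qed.

End Decomposition.
End GraphIdealTheory.

Theorem theorem5p5 (K : fieldType) (V : finType) (G : sgraph V)
  (GV : vset G = [set: V])
  (Giso : no_isolated G)
  (Gsum : clique_sums_of (@bipartite_or_odd_cycle V) G)
  (r : nat) (n : 'I_r -> nat)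
  (n_gt0 : forall i, (0 < n i)%N)
  (n_incr : forall i j : 'I_r, (i < j)%N -> (n i < n j)%N)
  (n_cycle : forall i, exists C, induced_cycle (n i).*2.+1 G C)
  (n_all : forall (m : nat) (C : sgraph V), odd m -> induced_cycle m G C ->
    exists i, is_cycle (n i).*2.+1 C)
  (s : nat) (s_ge2 : (2 <= s)%N) (f : {mpoly K[#|V|]}) :
  symbolic_power (edge_ideal K G) s f <->
  ideal_sum
    (fun ta : nat * ('I_r -> nat) =>
       s = (ta.1 + \sum_(i < r) (n i).+1 * ta.2 i)%N)
    (fun ta => ideal_mul (ideal_exp (edge_ideal K G) ta.1)
       (\big[@ideal_mul _/@ideal_one _]_(i < r)
          ideal_exp (odd_cycle_ideal K (n i) G) (ta.2 i)))
    f.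
Proof.
split=> [sf|[k [a [b [Jb ->]]]]].
  apply: ideal_monomials (ideal_gen_ideal _) _ => m mf.
  have pk := packable_leq (symbolic_power_monomials sf mf) (konig_clique_sums Gsum _).
  have [t [a [E Im]]] := packable_mixed_product K n_all pk.
  by apply: ideal_gen_sub; exists (t, a); rewrite -xpow_expo.
move=> P aP; have [Ppr _] := aP.
have idE := ideal_exp_ideal (edge_ideal K G) s.
apply/(extended_tofracP _ Ppr idE); apply: (ideal_sum_closed _ (saturation_ideal Ppr idE)).
move=> i; have [_ _ SM] := saturation_ideal Ppr idE; apply: SM.
have [ta [E Iba]] := Jb i.
apply/(extended_tofracP _ Ppr idE).
by rewrite E; apply: mixed_product_symbolic Iba _ aP.
Qed.
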